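(* Let $G$ be a connected Lie group and let $n$ be a positive integer. Denote $E_n(G)=\{g\in G\mid g^n=e\}$. Then each connected component of $E_n(G)$ is a conjugacy class of $G$.
   Context: Lie groups are real and finite-dimensional; $e$ is the identity element of $G$. $E_n(G)$ carries the subspace topology from $G$. A conjugacy class of $G$ is a set of the form $\{hgh^{-1}\mid h\in G\}$ for some $g\in G$. *)

(* Defs.v *)
From HB Require Import structures.
From mathcomp Require Import all_boot all_order all_algebra.
From mathcomp Require Import all_classical all_reals all_analysis.
Import numFieldNormedType.Exports.

Set Implicit Arguments.
Unset Strict Implicit.
Unset Printing Implicit Defensive.

Local Open Scope classical_set_scope.
Local Open Scope ring_scope.

(** Only used for open [U]: the conditions at [x \in U] then depend on the
    restriction of [f] to [U] alone, since continuity and partial derivatives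
    at [x] are determined by the values of [f] near [x]. *)
Fixpoint continuously_differentiable (R : realType) (m n : nat) (k : nat)
    (U : set 'rV[R]_m) (f : 'rV[R]_m -> 'rV[R]_n) : Prop :=
  (forall x, U x -> {for x, continuous f}) /\
  if k is k'.+1 then
    forall i : 'I_m,
      (forall x, U x -> derivable f x (delta_mx 0 i)) /\
      continuously_differentiable k' U (fun x => 'D_(delta_mx 0 i) f x)
  else True.

Definition smooth_on (R : realType) (m n : nat) (U : set 'rV[R]_m)
    (f : 'rV[R]_m -> 'rV[R]_n) : Prop :=
  forall k, continuously_differentiable k U f.

(** [chart_fun] and [chart_inv] are total functions; only their values on
    [chart_dom] and on its image, respectively, are meaningful. *)
Record chart (R : realType) (d : nat) (T : Type) := Chart {
  chart_dom : set T;
  chart_fun : T -> 'rV[R]_d;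
  chart_inv : 'rV[R]_d -> T }.

Definition chart_cod (R : realType) (d : nat) (T : Type) (c : chart R d T) :
  set 'rV[R]_d := chart_fun c @` chart_dom c.

Definition is_chart (R : realType) (d : nat) (T : topologicalType)
    (c : chart R d T) : Prop :=
  [/\ open (chart_dom c), open (chart_cod c),
      forall x, chart_dom c x -> chart_inv c (chart_fun c x) = x,
      forall x, chart_dom c x -> {for x, continuous (chart_fun c)} &
      forall v, chart_cod c v -> {for v, continuous (chart_inv c)}].

Definition smooth_atlas (R : realType) (d : nat) (T : topologicalType)
    (A : set (chart R d T)) : Prop :=
  [/\ forall c, A c -> is_chart c,
      forall x, exists2 c, A c & chart_dom c x &
      forall a b, A a -> A b ->
        smooth_on (chart_fun a @` (chart_dom a `&` chart_dom b))
                  (chart_fun b \o chart_inv a)].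

Definition smooth_map (R : realType) (d1 d2 : nat) (T1 T2 : topologicalType)
    (A1 : set (chart R d1 T1)) (A2 : set (chart R d2 T2)) (f : T1 -> T2) :
    Prop :=
  continuous f /\
  forall a b, A1 a -> A2 b ->
    smooth_on (chart_fun a @` (chart_dom a `&` f @^-1` chart_dom b))
              (chart_fun b \o f \o chart_inv a).

Definition prod_chart (R : realType) (d1 d2 : nat) (T1 T2 : Type)
    (a : chart R d1 T1) (b : chart R d2 T2) : chart R (d1 + d2) (T1 * T2) :=
  Chart (chart_dom a `*` chart_dom b)
        (fun p => row_mx (chart_fun a p.1) (chart_fun b p.2))
        (fun v => (chart_inv a (lsubmx v), chart_inv b (rsubmx v))).

Definition prod_atlas (R : realType) (d1 d2 : nat) (T1 T2 : Type)
    (A : set (chart R d1 T1)) (B : set (chart R d2 T2)) :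
    set (chart R (d1 + d2) (T1 * T2)) :=
  [set c | exists a b, [/\ A a, B b & c = prod_chart a b]].

HB.mixin Record isLieGroup (R : realType) (d : nat) G
    of Group G & Topological G := {
  lie_atlas : set (chart R d G);
  lie_hausdorff : hausdorff_space G;
  lie_second_countable : @second_countable G;
  lie_smooth_atlas : smooth_atlas lie_atlas;
  lie_smooth_mul : smooth_map (prod_atlas lie_atlas lie_atlas) lie_atlas
                     (fun p : G * G => (p.1 * p.2)%g);
  lie_smooth_inv : smooth_map lie_atlas lie_atlas (fun x : G => (x^-1)%g) }.

#[short(type="lieGroupType")]
HB.structure Definition LieGroup (R : realType) (d : nat) :=
  {G of isLieGroup R d G & Group G & Topological G}.

Definition torsion_set (G : groupType) (n : nat) : set G :=
  [set g : G | (g ^+ n)%g = 1%g].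

Arguments torsion_set : clear implicits.

Definition conj_class (G : groupType) (g : G) : set G :=
  [set (h * g * h^-1)%g | h in [set: G]].

(** The components of the subspace [E], as subsets of [T]: [connected] for a
    subset of [T] refers to its subspace topology. *)
Definition is_component (T : topologicalType) (E C : set T) : Prop :=
  exists2 x, E x & C = connected_component E x.

(* Main.v *)
Require Import Defs.
From mathcomp Require Import all_boot all_order all_algebra.
From mathcomp Require Import all_classical all_reals all_analysis.
From mathcomp Require Import ring lra.
Import Order.TTheory GRing.Theory Num.Theory.
Import numFieldNormedType.Exports.

(** The conjugacy class of a torsion element [g] is connected, as the image of
    the connected group [G] under [k |-> k g k^-1]; it remains to see that the
    conjugacy classes are relatively open in [torsion_set G n], for then they
    are also relatively closed and a component cannot meet two of them. In other
    words, a finite cyclic group has no non-trivial small deformations in [G]: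
    every [h] close enough to [g] with [h ^+ n = 1] is conjugate to [g].

    Let [phi] be a chart at [1]. If [G] were a linear group, the mean of the
    matrices [x_k = h ^+ k * g ^- k], [k < n], would conjugate [g] to [h]: since
    [x_(k+1) = h * x_k * g^-1] and [x_n = x_0], the mean [m] satisfies
    [h * m = m * g]. In general the mean is taken in the chart. The map
    [(x, y) |-> x * (g * y * g^-1)], which sends [(h * g^-1, x_k)] to [x_(k+1)],
    is affine up to a small error near [(1, 1)], and affine maps commute with
    means. So the element [k] with coordinates the mean of those of the [x_k]
    conjugates [h] to an element closer to [g] than [h] by a factor 2, while [k]
    is at a distance from [1] bounded by a multiple of the distance of [h] to
    [g] ([conj_improvement]).

    Instead of iterating this step and proving that the product of the
    conjugators converges, the proof minimises over [k] in a small compact ball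
    the distance of [k^-1 * h * k] to [g] plus a small multiple of the distance
    of [k] to [1] ([conj_class_near_torsion]). One more step from the minimiser
    would decrease the sum by a fixed proportion of its first term, which
    therefore vanishes.

    The only calculus involved is the strict differentiability of C1 maps
    ([C1_strictly_differentiable]), which follows from the mean value theorem
    along coordinate directions. It is used in two forms: near [1],
    multiplication is addition of coordinates up to a small Lipschitz error
    ([mulg_strictly_additive]), and conjugation by [g] is differentiable at [1]
    ([conj_differentiable]). *)

Set Implicit Arguments.
Unset Strict Implicit.
Unset Printing Implicit Defensive.

Local Open Scope classical_set_scope.
Local Open Scope ring_scope.

(** * Strict differentiability *)

Section strict_differentiability.
Context {R : realType}.

Lemma MVT_line m (f : 'rV[R]_m -> R) (w e : 'rV[R]_m) (a b : R) : a <= b ->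
  (forall t, t \in `[a, b] -> derivable f (w + t *: e) e) ->
  exists2 c, c \in `[a, b] &
    f (w + b *: e) - f (w + a *: e) = 'D_e f (w + c *: e) * (b - a).
Proof.
move=> ab df.
have E t : (fun h : R =>
      h^-1 *: (f (w + (h *: (1 : R) + t) *: e) - f (w + t *: e))) =
    (fun h : R => h^-1 *: (f (h *: e + (w + t *: e)) - f (w + t *: e))).
  by apply/funext => h; congr (_ *: (f _ - _)); rewrite scaler1 scalerDl addrCA.
pose g (t : R) : R := f (w + t *: e).
have dg t : t \in `[a, b] -> derivable g t 1.
  by move=> /df; rewrite /derivable /g /= -E.
apply: (@MVT_segment _ g (fun t => 'D_e f (w + t *: e))) => //.
- move=> t tab; apply: DeriveDef.
    by apply: dg; exact: subset_itv_oo_cc tab.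
  by rewrite /derive /g /= -E.
- exact: derivable_within_continuous.
Qed.

(** The hypothesis is only on the segment from [w] to [w + s *: e]: a larger one
    would leave the ball in which the derivative is controlled. *)
Lemma MVT_line_bound m (f : 'rV[R]_m -> R) (w e : 'rV[R]_m) (s c eps : R) :
  (forall t, (0 <= t <= s) || (s <= t <= 0) -> derivable f (w + t *: e) e /\
                             `|'D_e f (w + t *: e) - c| <= eps) ->
  `|f (w + s *: e) - f w - s * c| <= eps * `|s|.
Proof.
move=> H; have [s0|s0] := leP 0 s.
  have [|t /[!in_itv]/= /andP[t0 ts]] := @MVT_line m f w e 0 s s0.
    move=> t /[!in_itv]/= /andP[t0 ts].
    by apply: (H t _).1; rewrite t0 ts.
  rewrite scale0r addr0 subr0 => ->.
  rewrite mulrC -mulrBr normrM mulrC ler_wpM2r//.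
  by apply: (H t _).2; rewrite t0 ts.
have [|t /[!in_itv]/= /andP[t0 ts]] := @MVT_line m f w e s 0 (ltW s0).
  move=> t /[!in_itv]/= /andP[t0 ts].
  by apply: (H t _).1; rewrite t0 ts orbT.
rewrite scale0r addr0 sub0r => E.
have -> : f (w + s *: e) - f w = 'D_e f (w + t *: e) * s.
  by rewrite -opprB E mulrN opprK.
rewrite mulrC -mulrBr normrM mulrC ler_wpM2r//.
by apply: (H t _).2; rewrite t0 ts orbT.
Qed.

Lemma coord_le_norm m (u : 'rV[R]_m) i : `|u 0 i| <= `|u|.
Proof.
rewrite [leRHS]/Num.Def.normr/= mx_normrE.
exact: (le_bigmax _ (fun ij : 'I_1 * 'I_m => `|u ij.1 ij.2|) (0, i)).
Qed.

Lemma norm_le_coord m (u : 'rV[R]_m) c : 0 <= c ->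
  (forall i, `|u 0 i| <= c) -> `|u| <= c.
Proof.
move=> c0 uc; rewrite [leLHS]/Num.Def.normr/= mx_normrE.
by apply: bigmax_le => // -[i j] _ /=; rewrite ord1.
Qed.

Lemma norm_mulmx_le m n (A : 'M[R]_(m, n)) :
  exists2 K, 0 < K & forall u : 'rV_m, `|u *m A| <= K * `|u|.
Proof.
exists (1 + \sum_i `|row i A|).
  by rewrite ltr_wpDr// sumr_ge0.
move=> u; rewrite mulmx_sum_row (le_trans (ler_norm_sum _ _ _))//.
rewrite mulrDl mulr_suml ler_wpDl ?mul1r// ler_sum// => i _.
by rewrite normrZ mulrC ler_wpM2l// coord_le_norm.
Qed.

Lemma norm_row_mx_le m n (u : 'rV[R]_m) (v : 'rV[R]_n) :
  `|row_mx u v| <= `|u| + `|v|.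
Proof.
apply: norm_le_coord => [|i]; first by rewrite addr_ge0.
by rewrite mxE; case: splitP => j _; rewrite (le_trans (coord_le_norm _ _))//
  ?lerDl// lerDr.
Qed.

Lemma nbhs_rV_closed_ballP m (x : 'rV[R]_m) (U : set 'rV[R]_m) :
  nbhs x U <-> exists2 r, 0 < r & forall u, `|u - x| <= r -> U u.
Proof.
split=> [/nbhs_ballP[r/= r0 H]|[r r0 H]].
  exists (r / 2) => [|u ur]; first by rewrite divr_gt0.
  apply: H; rewrite -ball_normE/= distrC (le_lt_trans ur)//.
  by rewrite ltr_pdivrMr// ltr_pMr// ltr1n.
by apply/nbhs_ballP; exists r => //= u; rewrite -ball_normE/= distrC => /ltW/H.
Qed.

(** The error is compared with [u - v] for both points moving near [x], so the
    property contains a local Lipschitz estimate for [f], which Frechet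
    differentiability at [x] does not give. *)
Definition strictly_differentiable m n (f : 'rV[R]_m -> 'rV[R]_n) (x : 'rV[R]_m)
    (A : 'M[R]_(m, n)) :=
  forall eps, 0 < eps -> exists2 U, nbhs x U & forall u v, U u -> U v ->
    `|f u - f v - (u - v) *m A| <= eps * `|u - v|.

Lemma strictly_differentiable_comp m n p (f : 'rV[R]_m -> 'rV[R]_n)
    (g : 'rV[R]_n -> 'rV[R]_p) (x : 'rV[R]_m) A B : {for x, continuous f} ->
  strictly_differentiable f x A -> strictly_differentiable g (f x) B ->
  strictly_differentiable (g \o f) x (A *m B).
Proof.
move=> cf df dg e e0.
have [K K0 AK] := norm_mulmx_le A; have [L L0 BL] := norm_mulmx_le B.
have eL : 0 < Num.min 1 (e / (L *+ 2)).
  by rewrite lt_min ltr01 divr_gt0// mulrn_wgt0.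
have [U Ux dfU] := df _ eL.
have eK : 0 < e / ((K + 1) *+ 2) by rewrite divr_gt0// mulrn_wgt0// addr_gt0.
have [V Vx dgV] := dg _ eK.
exists (U `&` f @^-1` V) => [|u v [Uu Vu] [Uv Vv]/=].
  by apply: filterI => //; exact: cf.
have {}dfU := dfU _ _ Uu Uv; have {}dgV := dgV _ _ Vu Vv.
have fK : `|f u - f v| <= (K + 1) * `|u - v|.
  rewrite -[f u - f v](subrK ((u - v) *m A)) (le_trans (ler_normD _ _))//.
  rewrite mulrDl addrC lerD// (le_trans dfU)// ler_wpM2r//.
  by rewrite ge_min lexx.
rewrite mulmxA; set d := _ - (_ *m _).
have -> : d = (g (f u) - g (f v) - (f u - f v) *m B)
    + (f u - f v - (u - v) *m A) *m B.
  by rewrite /d (mulmxBl (f u - f v)) subrKA.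
rewrite (le_trans (ler_normD _ _))// (splitr e) mulrDl lerD//.
  rewrite (le_trans dgV)// (le_trans (ler_wpM2l (ltW eK) fK))// mulrA.
  rewrite ler_wpM2r// le_eqVlt; apply/orP; left; apply/eqP; field.
  by rewrite gt_eqF// addr_gt0.
rewrite (le_trans (BL _))// (le_trans (ler_wpM2l (ltW L0) dfU))// mulrA.
rewrite ler_wpM2r// mulrC -ler_pdivlMr// ge_min; apply/orP; right.
by rewrite -(mulr_natr L) invfM mulrA mulrAC.
Qed.

Lemma strictly_differentiable_affine m n (f : 'rV[R]_m -> 'rV[R]_n)
    (x : 'rV[R]_m) A :
  (forall u v, f u - f v = (u - v) *m A) -> strictly_differentiable f x A.
Proof.
move=> fA e e0; exists setT => [|u v _ _]; first exact: filterT.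
by rewrite fA subrr normr0 mulr_ge0// ltW.
Qed.

(** Going from [v] to [u] by changing one coordinate at a time stays in any ball
    of the sup norm that contains [u] and [v], and the mean value theorem bounds
    each move. *)
Lemma C1_strictly_differentiable m n (f : 'rV[R]_m -> 'rV[R]_n) (x : 'rV[R]_m) :
  (forall i : 'I_m, (\forall u \near x, derivable f u (delta_mx 0 i)) /\
     {for x, continuous (fun u => 'D_(delta_mx 0 i) f u)}) ->
  strictly_differentiable f x (\matrix_(i, j) 'D_(delta_mx 0 i) f x 0 j).
Proof.
move=> df; rewrite /strictly_differentiable; set A := \matrix_(_, _) _ => e e0.
(* there are [m] moves; the [+ 1] keeps [e'] meaningful when [m = 0] *)
pose e' := e / (m%:R + 1).
have m0 : 0 < m%:R + 1 :> R by rewrite ltr_wpDl.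
have e'0 : 0 < e' by rewrite divr_gt0.
have : \forall u \near x, forall i : 'I_m, derivable f u (delta_mx 0 i) /\
   `|'D_(delta_mx 0 i) f u - 'D_(delta_mx 0 i) f x| <= e'.
  apply: (@filter_forall _ _ _ _ (nbhs_filter x)) => i; have [d1 d2] := df i.
  apply: filterS2 d1 ((cvgrPdist_le _ _).1 d2 _ e'0) => u.
  by rewrite distrC.
move=> /nbhs_rV_closed_ballP[r r0 dfr].
exists [set u | `|u - x| <= r]; first by apply/nbhs_rV_closed_ballP; exists r.
move=> u v /= ur vr.
pose w k := \row_j (if (j < k)%N then u 0 j else v 0 j).
have -> : f u - f v = \sum_(0 <= k < m) (f (w k.+1) - f (w k)).
  rewrite telescope_sumr//; congr (f _ - f _); apply/rowP => j.
    by rewrite mxE ltn_ord.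
  by rewrite mxE.
rewrite big_mkord mulmx_sum_row -sumrB.
apply: norm_le_coord => [|j]; first by rewrite mulr_ge0// ltW.
have -> : e * `|u - v| = e' * (m%:R + 1) * `|u - v|.
  by rewrite /e' divfK// gt_eqF.
rewrite summxE (le_trans (ler_norm_sum _ _ _))//.
apply: (@le_trans _ _ (\sum_(i < m) e' * `|u - v|)); last first.
  rewrite sumr_const card_ord -(mulr_natr (e' * _)) mulrAC ler_wpM2r//.
  by rewrite ler_wpM2l ?lerDl// ltW.
apply: ler_sum => i _.
pose s := (u - v) 0 i.
have wS : w i.+1 = w i + s *: delta_mx 0 i.
  apply/rowP => k; rewrite /s !mxE eqxx/= ltnS leq_eqVlt.
  have [->|ki] := eqVneq k i; first by rewrite eqxx ltnn/= mulr1 addrC subrK.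
  by rewrite (negPf (ki : (k : nat) != i)) mulr0 addr0.
have -> : (f (w i.+1) - f (w i) - (u - v) 0 i *: row i A) 0 j =
    f (w i + s *: delta_mx 0 i) 0 j - f (w i) 0 j
    - s * 'D_(delta_mx 0 i) f x 0 j by rewrite -wS /s !mxE.
apply: (le_trans (MVT_line_bound (f := fun p => f p 0 j) (eps := e') _));
  last first.
  by rewrite ler_wpM2l ?coord_le_norm// ltW.
move=> t ts.
have [|di dbi] := dfr (w i + t *: delta_mx 0 i) _ i.
  apply: norm_le_coord => [|k]; first exact: ltW.
  rewrite !mxE eqxx/=.
  have := le_trans (coord_le_norm _ k) ur.
  have := le_trans (coord_le_norm _ k) vr.
  rewrite !mxE; have [->|ki] := eqVneq k i; last first.
    by rewrite mulr0 addr0; case: ifP.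
  rewrite ltnn mulr1; move: ts; rewrite /s !mxE.
  by rewrite !ler_norml => /orP[]/andP[? ?] /andP[? ?] /andP[? ?]; lra.
split; first exact: (derivable_mxP _ _ _).1.
move: dbi; rewrite derive_mx// => /(le_trans (coord_le_norm _ j)).
by rewrite !mxE.
Qed.

Lemma strictly_differentiable_continuous m n (f : 'rV[R]_m -> 'rV[R]_n)
   (x : 'rV[R]_m) A :
  strictly_differentiable f x A -> {for x, continuous f}.
Proof.
move=> df; have [K K0 AK] := norm_mulmx_le A.
have [U Ux dfU] := df 1 ltr01.
have xU : U x by exact: nbhs_singleton.
apply: (cvgrPdist_le (FF := nbhs_filter x) f (f x)).2 => e e0.
have near_x : \forall u \near x, `|u - x| <= e / (1 + K).
  apply/nbhs_rV_closed_ballP; exists (e / (1 + K)) => //.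
  by rewrite divr_gt0// addr_gt0.
apply: (@filterS2 _ _ (nbhs_filter x) _ _ _ _ Ux near_x) => u uU ux.
rewrite distrC -[f u - f x](subrK ((u - x) *m A)) (le_trans (ler_normD _ _))//.
apply: (@le_trans _ _ ((1 + K) * `|u - x|)).
  by rewrite mulrDl lerD// (le_trans (dfU _ _ uU xU)).
by rewrite mulrC -ler_pdivlMr// addr_gt0.
Qed.

Lemma smooth_on_strictly_differentiable m n (U : set 'rV[R]_m)
    (f : 'rV[R]_m -> 'rV[R]_n) (x : 'rV[R]_m) :
  smooth_on U f -> nbhs x U -> exists A, strictly_differentiable f x A.
Proof.
move=> /(_ 1%N)[_ df] Ux; eexists; apply: C1_strictly_differentiable => i.
have [d1 [d2 _]] := df i; split; first by near do apply: d1.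
by apply: d2; exact: nbhs_singleton.
Unshelve. all: by end_near. Qed.

Lemma row_mxB m n (u u' : 'rV[R]_m) (v v' : 'rV[R]_n) :
  row_mx u v - row_mx u' v' = row_mx (u - u') (v - v').
Proof. by rewrite opp_row_mx add_row_mx. Qed.

Lemma row_mx_strictly_differentiable_l m n (u : 'rV[R]_n) (x : 'rV[R]_m) :
  strictly_differentiable (fun v => row_mx v u) x (row_mx 1%:M 0).
Proof.
apply: strictly_differentiable_affine => v w.
by rewrite row_mxB subrr mul_mx_row mulmx1 mulmx0.
Qed.

Lemma row_mx_strictly_differentiable_r m n (u : 'rV[R]_m) (x : 'rV[R]_n) :
  strictly_differentiable (fun v => row_mx u v) x (row_mx 0 1%:M).
Proof.
apply: strictly_differentiable_affine => v w.
by rewrite row_mxB subrr mul_mx_row mulmx1 mulmx0.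
Qed.

Lemma lsubmx_strictly_differentiable m n (x : 'rV[R]_(m + n)) :
  strictly_differentiable (fun v => lsubmx v) x (col_mx 1%:M 0).
Proof.
apply: strictly_differentiable_affine => v w.
rewrite -[v in RHS]hsubmxK -[w in RHS]hsubmxK row_mxB.
by rewrite mul_row_col mulmx1 mulmx0 addr0.
Qed.

Lemma rsubmx_strictly_differentiable m n (x : 'rV[R]_(m + n)) :
  strictly_differentiable (fun v => rsubmx v) x (col_mx 0 1%:M).
Proof.
apply: strictly_differentiable_affine => v w.
rewrite -[v in RHS]hsubmxK -[w in RHS]hsubmxK row_mxB.
by rewrite mul_row_col mulmx1 mulmx0 add0r.
Qed.

End strict_differentiability.

(** * Lie groups: continuity and charts *)

Section lie_group.
Context {R : realType} {d : nat} (G : lieGroupType R d).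
Local Notation atlas := (@lie_atlas R d G).
Implicit Types (x y g : G) (a b c : chart R d G).

Lemma mulg_near x y (W : set G) : nbhs (x * y)%g W ->
  \forall u \near x & v \near y, W (u * v)%g.
Proof. by move=> Wxy; exact: ((@lie_smooth_mul R d G).1 (x, y) W Wxy). Qed.

Lemma mulgl_continuous g : continuous (fun x => (g * x)%g).
Proof.
move=> x W /mulg_near[[A B] /= [Ag Bx] AB].
apply: filterS Bx => y By; apply: (AB (g, y)).
by split => //=; exact: nbhs_singleton.
Qed.

Lemma invg_continuous : continuous (fun x : G => x^-1)%g.
Proof. exact: (@lie_smooth_inv R d G).1. Qed.

Lemma is_chart_atlas a : atlas a -> is_chart a.
Proof. by have [+ _ _] := @lie_smooth_atlas R d G; exact. Qed.

Lemma atlas_cover x : exists2 a, atlas a & chart_dom a x.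
Proof. by have [_ + _] := @lie_smooth_atlas R d G; exact. Qed.

Lemma chart_dom_nbhs a x : atlas a -> chart_dom a x -> nbhs x (chart_dom a).
Proof. by move=> /is_chart_atlas[oa _ _ _ _] ax; exact: open_nbhs_nbhs. Qed.

Lemma chart_cod_nbhs a x : atlas a -> chart_dom a x ->
  nbhs (chart_fun a x) (chart_cod a).
Proof.
move=> /is_chart_atlas[_ oa _ _ _] ax; apply: open_nbhs_nbhs; split => //.
by exists x.
Qed.

Lemma chart_funK a x : atlas a -> chart_dom a x ->
  chart_inv a (chart_fun a x) = x.
Proof. by move=> /is_chart_atlas[_ _ + _ _]; exact. Qed.

Lemma chart_invK a v : atlas a -> chart_cod a v ->
  chart_fun a (chart_inv a v) = v.
Proof. by move=> aa [x ax <-]; rewrite chart_funK. Qed.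

Lemma chart_inv_dom a v : atlas a -> chart_cod a v ->
  chart_dom a (chart_inv a v).
Proof. by move=> aa [x ax <-]; rewrite chart_funK. Qed.

Lemma chart_fun_continuous a x : atlas a -> chart_dom a x ->
  {for x, continuous (chart_fun a)}.
Proof. by move=> /is_chart_atlas[_ _ _ + _]; exact. Qed.

Lemma chart_inv_continuous a v : atlas a -> chart_cod a v ->
  {for v, continuous (chart_inv a)}.
Proof. by move=> /is_chart_atlas[_ _ _ _]; exact. Qed.

Lemma chart_inv_near a x (W : set G) : atlas a -> chart_dom a x -> nbhs x W ->
  \forall v \near chart_fun a x, chart_cod a v /\ W (chart_inv a v).
Proof.
move=> aa ax Wx; apply: filterI; first exact: chart_cod_nbhs.
by apply: (chart_inv_continuous aa); [exists x|rewrite chart_funK].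
Qed.

(** Smoothness is given in the charts of the product atlas on the set of pairs
    whose product lies in the domain of [c]; what has to be checked is that this
    set is a neighbourhood of [(x, y)]. *)
Lemma mulg_strictly_differentiable a b c x y : atlas a -> atlas b -> atlas c ->
  chart_dom a x -> chart_dom b y -> chart_dom c (x * y)%g ->
  exists A, strictly_differentiable
    (fun v => chart_fun c (chart_inv a (lsubmx v) * chart_inv b (rsubmx v))%g)
    (row_mx (chart_fun a x) (chart_fun b y)) A.
Proof.
move=> aa ab ac ax by_ cxy.
have := (@lie_smooth_mul R d G).2 (prod_chart a b) c.
move=> /(_ _ ac)/smooth_on_strictly_differentiable; apply; first by exists a, b.
have [[A B] /= [Ax By] AB] := mulg_near (chart_dom_nbhs ac cxy).
have := chart_inv_near aa ax Ax; have := chart_inv_near ab by_ By.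
set p := row_mx _ _.
have /strictly_differentiable_continuous Cl := lsubmx_strictly_differentiable p.
have /strictly_differentiable_continuous Cr := rsubmx_strictly_differentiable p.
rewrite -[chart_fun a x](row_mxKl _ (chart_fun b y)).
rewrite -{1}[chart_fun b y](row_mxKr (chart_fun a x)) -/p.
move=> /Cr br /Cl al.
apply: (@filterS2 _ _ (nbhs_filter p) _ _ _ _ br al).
move=> v [/= bv Bv] [/= av Av].
exists (chart_inv a (lsubmx v), chart_inv b (rsubmx v)) => /=.
  split; first by split; exact: chart_inv_dom.
  exact: (AB (_, _)).
by rewrite !chart_invK// hsubmxK.
Qed.

Lemma mulgl_strictly_differentiable b c x y : atlas b -> atlas c ->
  chart_dom b y -> chart_dom c (x * y)%g ->
  exists A, strictly_differentiable
    (fun v => chart_fun c (x * chart_inv b v)%g) (chart_fun b y) A.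
Proof.
move=> ab ac by_ cxy; have [a aa ax] := atlas_cover x.
have [A dA] := mulg_strictly_differentiable aa ab ac ax by_ cxy.
have dr := row_mx_strictly_differentiable_r (chart_fun a x) (chart_fun b y).
have := strictly_differentiable_comp
  (strictly_differentiable_continuous dr) dr dA.
set h := (_ \o _); suff -> : h = (fun v => chart_fun c (x * chart_inv b v)%g).
  by move=> ?; eexists; eassumption.
by apply/funext => v; rewrite /h/= row_mxKl row_mxKr chart_funK.
Qed.

Lemma mulgr_strictly_differentiable a c x y : atlas a -> atlas c ->
  chart_dom a x -> chart_dom c (x * y)%g ->
  exists A, strictly_differentiable
    (fun v => chart_fun c (chart_inv a v * y)%g) (chart_fun a x) A.
Proof.
move=> aa ac ax cxy; have [b ab by_] := atlas_cover y.
have [A dA] := mulg_strictly_differentiable aa ab ac ax by_ cxy.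
have dl := row_mx_strictly_differentiable_l (chart_fun b y) (chart_fun a x).
have := strictly_differentiable_comp
  (strictly_differentiable_continuous dl) dl dA.
set h := (_ \o _); suff -> : h = (fun v => chart_fun c (chart_inv a v * y)%g).
  by move=> ?; eexists; eassumption.
by apply/funext => v; rewrite /h/= row_mxKl row_mxKr chart_funK.
Qed.

Lemma cvg_mulg T (F : set_system T) (FF : Filter F) (f h : T -> G) x y :
  f @ F --> x -> h @ F --> y -> (fun t => f t * h t)%g @ F --> (x * y)%g.
Proof.
move=> fx hy; apply: continuous2_cvg => //.
exact: ((@lie_smooth_mul R d G).1 (x, y)).
Qed.

Lemma cvg_invg T (F : set_system T) (FF : Filter F) (f : T -> G) x :
  f @ F --> x -> (fun t => (f t)^-1)%g @ F --> (x^-1)%g.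
Proof. by move=> fx; apply: continuous_cvg => //; exact: invg_continuous. Qed.

Lemma cvg_expg T (F : set_system T) (FF : Filter F) (f : T -> G) x k :
  f @ F --> x -> (fun t => f t ^+ k)%g @ F --> (x ^+ k)%g.
Proof.
move=> fx; elim: k => [|k IH].
  by rewrite expg0; under eq_fun do rewrite expg0; exact: cvg_cst.
by rewrite expgS; under eq_fun do rewrite expgS; exact: cvg_mulg.
Qed.

(** The residual of an affine recursion is affine, so the residual at the mean of
    an orbit is the mean of the residuals, as long as shifting the orbit does not
    change its mean. *)
Lemma mean_residual n (y : nat -> 'rV[R]_d) (xi : 'rV[R]_d) (A : 'M[R]_d)
    (m := n%:R^-1 *: \sum_(k < n) y k) : (0 < n)%N ->
  \sum_(k < n) y k.+1 = \sum_(k < n) y k ->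
  m - (xi + m *m A) = n%:R^-1 *: \sum_(k < n) (y k.+1 - (xi + y k *m A)).
Proof.
move=> n0 yS; rewrite sumrB big_split/= sumr_const card_ord yS -mulmx_suml.
rewrite scalerBr scalerDr -(scaler_nat n xi) scalerA mulVf ?pnatr_eq0 -?lt0n//.
by rewrite scale1r scalemxAl.
Qed.

Lemma cvg_weighted_dist T (F : set_system T) (FF : Filter F)
    (p q : T -> 'rV[R]_d) (p0 q0 z : 'rV[R]_d) (c : R) :
  p @ F --> p0 -> q @ F --> q0 ->
  (fun t => `|p t - z| + c * `|q t - z|) @ F --> `|p0 - z| + c * `|q0 - z|.
Proof.
move=> pF qF; apply: cvgD; last apply: cvgM.
- by apply: cvg_norm; apply: cvgB => //; exact: cvg_cst.
- exact: cvg_cst.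
- by apply: cvg_norm; apply: cvgB => //; exact: cvg_cst.
Qed.

(** * The group law in a chart at the identity *)

Section chart_at_identity.
Variables (a : chart R d G) (aa : atlas a) (a1 : chart_dom a 1%g).
Local Notation phi := (chart_fun a).
Local Notation psi := (chart_inv a).
Local Notation N x := (`|phi x%g - phi 1%g|).

(** Conjugation by [g] moves away from [1] before coming back, so it is the
    composite of two translations read in a chart at [1] and a chart at [g]. *)
Lemma conj_differentiable g : exists A : 'M[R]_d, forall eps, 0 < eps ->
  exists2 V : set G, nbhs (1%g : G) V & forall y, V y ->
    `|phi (g * y * g^-1)%g - phi 1%g - (phi y - phi 1%g) *m A|
      <= eps * `|phi y - phi 1%g|.
Proof.
have [b ab bg] := atlas_cover g.
have bg1 : chart_dom b (g * 1)%g by rewrite mulg1.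
have agg : chart_dom a (g * g^-1)%g by rewrite mulgV.
have [A dA] := mulgl_strictly_differentiable aa ab a1 bg1.
have [B dB] := mulgr_strictly_differentiable ab aa bg agg.
have Eg : chart_fun b (g * psi (phi 1))%g = chart_fun b g.
  by rewrite chart_funK// mulg1.
rewrite -Eg in dB.
have dAB := strictly_differentiable_comp
  (strictly_differentiable_continuous dA) dA dB.
exists (A *m B) => e /dAB[U U1 dU].
exists [set y | chart_dom a y /\ chart_dom b (g * y)%g /\ U (phi y)].
  apply: filterI; first exact: chart_dom_nbhs.
  apply: filterI; last exact: (chart_fun_continuous aa).
  by apply: mulgl_continuous; exact: chart_dom_nbhs.
move=> y [ay [bgy Uy]]; have := dU _ _ Uy (nbhs_singleton U1).
by rewrite /= !chart_funK// ?mulg1 ?mulgV// chart_funK.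
Qed.

Lemma chart_ball (r : R) : 0 < r ->
  nbhs (1%g : G) [set x | `|phi x - phi 1%g| <= r].
Proof.
move=> r0; have H : nbhs (phi 1%g) [set v | `|v - phi 1%g| <= r].
  by apply/nbhs_rV_closed_ballP; exists r.
exact: (chart_fun_continuous aa a1 H).
Qed.

(** The derivative of multiplication at [(1, 1)] is addition, because [x * 1 = x]
    and [1 * y = y]. Taking [x' = x] and [y' = 1] gives the comparison, up to a
    factor close to 1, of the distances from [x] to [x * y] and from [1] to
    [y]. *)
Lemma mulg_strictly_additive eps : 0 < eps ->
  exists2 V : set G, nbhs (1%g : G) V & forall x y x' y',
    V x -> V y -> V x' -> V y' ->
    `|phi (x * y)%g - phi (x' * y')%g - (phi x - phi x' + (phi y - phi y'))|
      <= eps * (`|phi x - phi x'| + `|phi y - phi y'|).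
Proof.
move=> e0.
have a11 : chart_dom a (1 * 1)%g by rewrite mulg1.
have [A dA] := mulg_strictly_differentiable aa aa aa a1 a1 a11.
have e20 : 0 < eps / 2 by rewrite divr_gt0.
have [U /nbhs_rV_closed_ballP[r r0 rU] dU] := dA _ e20.
have r20 : 0 < r / 2 by rewrite divr_gt0.
exists [set x | chart_dom a x /\ `|phi x - phi 1%g| <= r / 2].
  by apply: filterI; [exact: chart_dom_nbhs|exact: chart_ball].
have {rU} rU x y : `|phi x - phi 1%g| <= r / 2 -> `|phi y - phi 1%g| <= r / 2 ->
    U (row_mx (phi x) (phi y)).
  move=> xr yr; apply: rU; rewrite row_mxB (le_trans (norm_row_mx_le _ _))//.
  by rewrite (splitr r) lerD.
have {}dU x y x' y' : chart_dom a x /\ `|phi x - phi 1%g| <= r / 2 ->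
    chart_dom a y /\ `|phi y - phi 1%g| <= r / 2 ->
    chart_dom a x' /\ `|phi x' - phi 1%g| <= r / 2 ->
    chart_dom a y' /\ `|phi y' - phi 1%g| <= r / 2 ->
    `|phi (x * y)%g - phi (x' * y')%g
        - row_mx (phi x - phi x') (phi y - phi y') *m A|
      <= eps / 2 * (`|phi x - phi x'| + `|phi y - phi y'|).
  move=> [ax xr] [ay yr] [ax' xr'] [ay' yr'].
  have := dU _ _ (rU _ _ xr yr) (rU _ _ xr' yr').
  rewrite !row_mxKl !row_mxKr !chart_funK// row_mxB => /le_trans; apply.
  by rewrite ler_wpM2l ?norm_row_mx_le// ltW.
have V1 : chart_dom a 1%g /\ `|phi 1%g - phi 1%g| <= r / 2.
  by rewrite subrr normr0 ltW.
move=> x y x' y' Vx Vy Vx' Vy' /=.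
(* comparing with (x, 1), (x', 1) and with (1, y), (1, y') shows that the
   derivative is close to the sum on the increments at hand *)
have := dU _ _ _ _ Vx V1 Vx' V1; have := dU _ _ _ _ V1 Vy V1 Vy'.
have := dU _ _ _ _ Vx Vy Vx' Vy'.
rewrite !mulg1 !mul1g !subrr normr0 addr0 add0r.
set X := phi x - phi x'; set Y := phi y - phi y'.
have -> : row_mx X Y = row_mx X 0 + row_mx 0 Y.
  by rewrite add_row_mx addr0 add0r.
rewrite mulmxDl.
set P := row_mx X 0 *m A; set Q := row_mx 0 Y *m A => h1 h2 h3.
set Z := phi (x * y)%g - _ in h1 *.
have -> : Z - (X + Y) = (Z - (P + Q)) - ((X - P) + (Y - Q)).
  by rewrite [X - P + _]addrACA -opprD opprB subrKA.
have := ler_normB (Z - (P + Q)) ((X - P) + (Y - Q)).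
have := ler_normD (X - P) (Y - Q).
lra.
Qed.

(** For [x = h * g^-1] the map [y |-> x * (g * y * g^-1)] is [y |-> h * y * g^-1],
    whose fixed points are the elements conjugating [g] to [h]. *)
Lemma mulg_conj_differentiable g : exists A : 'M[R]_d, forall eps, 0 < eps ->
  exists2 V : set G, nbhs (1%g : G) V & forall x y, V x -> V y ->
    `|phi (x * (g * y * g^-1))%g - phi 1%g
        - (phi x - phi 1%g + (phi y - phi 1%g) *m A)| <= eps * (N x + N y).
Proof.
have [A dA] := conj_differentiable g; exists A => e e0.
have [K K0 AK] := norm_mulmx_le A.
pose e' := Num.min 1 (e / (K + 2)).
have e'0 : 0 < e' by rewrite lt_min ltr01 divr_gt0// addr_gt0.
have e'1 : e' <= 1 by rewrite ge_min lexx.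
have e'e : e' * (K + 2) <= e.
  by rewrite -ler_pdivlMr ?addr_gt0// ge_min lexx orbT.
have [V V1 dV] := dA _ e'0.
have [W W1 dW] := mulg_strictly_additive e'0.
exists (W `&` (V `&` [set y | W (g * y * g^-1)%g])).
  apply: filterI => //; apply: filterI => //.
  have : (fun y => g * y * g^-1)%g @ (1%g : G) --> (g * 1 * g^-1)%g.
    apply: cvg_mulg; last exact: cvg_cst.
    by apply: cvg_mulg; [exact: cvg_cst|exact: cvg_id].
  by rewrite mulg1 mulgV; exact.
move=> x y [Wx [Vx Wgx]] [Wy [Vy Wgy]].
have := dW _ _ _ _ Wx Wgy (nbhs_singleton W1) (nbhs_singleton W1).
have := dV _ Vy; have := AK (phi y - phi 1%g); rewrite mulg1.
set X := phi x - _; set Y := phi y - _; set C := phi (g * y * g^-1)%g - _.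
set Z := phi (x * _)%g - _; set P := Y *m A => h1 h2 h3.
have -> : Z - (X + P) = (Z - (X + C)) + (C - P).
  by move: (Z) (X) (C) (P) => z x0 c p; rewrite !opprD !addrA subrK.
rewrite (le_trans (ler_normD _ _))//.
have x0 := normr_ge0 X; have y0 := normr_ge0 Y.
have q : `|C| <= (K + 1) * `|Y|.
  rewrite -[C](subrK P) (le_trans (ler_normD _ _))// addrC mulrDl lerD//.
  by rewrite (le_trans h2)// ler_wpM2r.
apply: (@le_trans _ _ (e' * (K + 2) * (`|X| + `|Y|))); last first.
  by rewrite ler_wpM2r// addr_ge0.
rewrite (le_trans (lerD h3 h2))// -mulrDr -mulrA ler_wpM2l ?(ltW e'0)//.
by have := mulr_ge0 (ltW K0) x0; lra.
Qed.

(** * Local rigidity of torsion elements *)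

Lemma cvg_cocycle g k :
  (fun h : G => h ^+ k * (g ^+ k)^-1)%g @ g --> (1%g : G).
Proof.
rewrite -(mulgV (g ^+ k)%g); apply: cvg_mulg; last exact: cvg_cst.
by apply: cvg_expg; exact: cvg_id.
Qed.

Lemma cocycleS g (h : G) k : (h ^+ k.+1 * (g ^+ k.+1)^-1)%g =
  (h * g^-1 * (g * (h ^+ k * (g ^+ k)^-1) * g^-1))%g.
Proof. by rewrite !expgS invgM !mulgA mulgVK. Qed.

Lemma cvg_mulVr g : (fun h : G => h * g^-1)%g @ g --> (1%g : G).
Proof. by have := cvg_cocycle g 1; under eq_fun do rewrite !expg1. Qed.

(** One iteration of [y |-> x * (g * y * g^-1)] multiplies the size of [y] by a
    constant at most, plus a multiple of the size of [x]. *)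
Lemma cocycle_bound g n : exists2 C, 0 < C & \forall h \near g,
  forall k, (k <= n)%N -> N (h ^+ k * (g ^+ k)^-1) <= C * N (h * g^-1).
Proof.
have [A dA] := mulg_conj_differentiable g; have [K K0 AK] := norm_mulmx_le A.
have [V V1 dV] := dA _ ltr01.
elim: n => [|n [C C0 IH]].
  exists 1 => //; apply: (@filterE _ (nbhs g)) => h k; rewrite leqn0 => /eqP->.
  by rewrite !expg0 invg1 mulg1 subrr normr0 mulr_ge0.
exists (C + (2 + (K + 1) * C)).
  by rewrite !addr_gt0// mulr_gt0// addr_gt0.
apply: filterS3 IH (cvg_cocycle g n V1) (cvg_mulVr g V1) => h IH Vn V0 k.
have CN := IH _ (leqnn n).
have N0 := normr_ge0 (phi (h * g^-1)%g - phi 1%g).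
rewrite leq_eqVlt => /orP[/eqP->|]; last first.
  rewrite ltnS => /IH kC; rewrite mulrDl ler_wpDr// mulr_ge0// addr_ge0//.
  by rewrite mulr_ge0 ?addr_ge0// ltW.
rewrite cocycleS; have := dV _ _ V0 Vn; rewrite mul1r.
move: (AK (phi (h ^+ n * (g ^+ n)^-1)%g - phi 1%g)) => Ah dh.
set X := phi (h * g^-1)%g - _ in dh N0 CN *.
set Y := phi (h ^+ n * _)%g - _ in Ah dh CN.
set Z := phi _ - _ in dh *.
rewrite -[Z](subrK (X + Y *m A)) (le_trans (ler_normD _ _))//.
rewrite (le_trans (lerD dh (ler_normD _ _)))//.
have := mulr_ge0 (ltW C0) N0.
have := ler_wpM2l (ltW K0) CN.
lra.
Qed.

(** The conjugator [k] has for coordinates the mean of the coordinates of the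
    [h ^+ i * g ^- i], [i < n]. These form an orbit of [y |-> h * y * g^-1], of
    period [n] as [h ^+ n = g ^+ n = 1]; since this map is nearly affine, it
    nearly fixes [k], that is, [k^-1 * h * k] is much closer to [g] than [h]. *)
Lemma conj_improvement g n : (0 < n)%N -> (g ^+ n)%g = 1%g ->
  exists2 C, 0 < C & forall W : set G, nbhs (1%g : G) W ->
  \forall h \near g, (h ^+ n)%g = 1%g ->
    exists k : G, [/\ W k, N k <= C * N (h * g^-1) &
      N (k^-1 * h * k * g^-1) <= N (h * g^-1) / 2].
Proof.
move=> n0 gn; have [C C0 Cbound] := cocycle_bound g n; exists C => // W W1.
have [A dA] := mulg_conj_differentiable g.
(* the errors add up to [2 * e * (1 + C)] times the distance of [h] to [g], and
   at most double when the conjugate is moved back to a neighbourhood of 1 *)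
have e0 : 0 < (8 * (1 + C))^-1 by rewrite invr_gt0 mulr_gt0// addr_gt0.
set e := _^-1 in e0.
have [V V1 dV] := dA _ e0.
have half0 : (0 : R) < 1 / 2 by rewrite divr_gt0.
have [U U1 dU] := mulg_strictly_additive half0.
have : (fun p : G * G => p.1^-1 * p.2 * p.1 * g^-1)%g @ ((1%g : G), g)
    --> (1%g : G).
  rewrite [X in _ --> X](_ : _ = 1^-1 * g * 1 * g^-1)%g; last first.
    by rewrite invg1 mul1g mulg1 mulgV.
  do 3!(apply: cvg_mulg;
    last by [exact: cvg_snd|exact: cvg_fst|exact: cvg_cst]).
  apply: cvg_invg; exact: cvg_fst.
move=> /(_ _ U1)[[P Q] /= [P1 Qg] PQ].
have hV0 : \forall h \near g, V (h * g^-1)%g by exact: cvg_mulVr.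
have [r r0 rP] := (nbhs_rV_closed_ballP _ _).1
  (chart_inv_near aa a1 (filterI W1 (filterI V1 (filterI U1 P1)))).
have rC0 : 0 < r / C by rewrite divr_gt0.
have hr : \forall h \near g, N (h * g^-1) <= r / C.
  exact: (cvg_mulVr g (chart_ball rC0)).
have hVall : \forall h \near g, forall k : 'I_n, V (h ^+ k * (g ^+ k)^-1)%g.
  apply: (@filter_forall _ _ _ _ (nbhs_filter g)) => k.
  exact: cvg_cocycle V1.
apply: filterS3 (filterI Cbound hVall) (filterI hV0 hr) Qg.
move=> h [{}Cbound {}hVall] [{}hV0 {}hr] Qh hn.
set xi := phi (h * g^-1)%g - phi 1%g in Cbound hr *.
have xi0 := normr_ge0 xi.
pose y k := phi (h ^+ k * (g ^+ k)^-1)%g - phi 1%g.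
pose m := n%:R^-1 *: \sum_(k < n) y k.
have nR0 : 0 < n%:R :> R by rewrite ltr0n.
have mean_le (F : 'I_n -> 'rV[R]_d) (b : R) :
    (forall k, `|F k| <= b) -> `|n%:R^-1 *: \sum_k F k| <= b.
  move=> Fc; rewrite normrZ gtr0_norm ?invr_gt0// ler_pdivrMl//.
  rewrite (le_trans (ler_norm_sum _ _ _))//.
  rewrite (le_trans (ler_sum _ (fun k _ => Fc k)))//.
  by rewrite sumr_const card_ord mulr_natl.
have yC k : (k <= n)%N -> `|y k| <= C * `|xi| by exact: Cbound.
have mC : `|m| <= C * `|xi| by apply: mean_le => k; apply: yC; exact: ltnW.
have [|cm [Wm [Vm [Um Pm]]]] := rP (phi 1%g + m).
  by rewrite addrC addKr (le_trans mC)// mulrC -ler_pdivlMr.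
set k0 := psi (phi 1%g + m) in Wm Vm Um Pm.
have phik0 : phi k0 - phi 1%g = m by rewrite chart_invK// addrC addKr.
exists k0; rewrite phik0; split => //.
have sumyS : \sum_(k < n) y k.+1 = \sum_(k < n) y k.
  transitivity (\sum_(k < n.+1) y k).
    by rewrite big_ord_recl /y !expg0 invg1 mulg1 subrr add0r.
  by rewrite big_ord_recr/= {2}/y hn gn invg1 mulg1 subrr addr0.
have mE := mean_residual xi A n0 sumyS; rewrite -/m in mE.
have dm : `|m - (xi + m *m A)| <= e * (1 + C) * `|xi|.
  rewrite mE; apply: mean_le => k.
  rewrite /y cocycleS (le_trans (dV _ _ hV0 (hVall k)))// -mulrA.
  rewrite ler_wpM2l ?(ltW e0)//.
  by rewrite mulrDl mul1r lerD2l yC// ltnW.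
have := dV _ _ hV0 Vm; rewrite phik0 -/xi => dk.
have UPQ : U (k0^-1 * h * k0 * g^-1)%g by exact: (PQ (k0, h)).
have := dU _ _ _ _ Um UPQ Um (nbhs_singleton U1).
rewrite mulg1 subrr normr0 !add0r.
have -> : (k0 * (k0^-1 * h * k0 * g^-1) = h * g^-1 * (g * k0 * g^-1))%g.
  by rewrite !mulgA mulgV mul1g mulgVK.
(* [T - phi k0] measures how far k0 is from being fixed by y |-> h * y * g^-1 *)
set T := phi (h * g^-1 * _)%g in dk *; set w := phi (k0^-1 * _ * _ * _)%g - _.
have -> : T - phi k0 = (T - phi 1%g - (xi + m *m A)) - (m - (xi + m *m A)).
  by move: (xi + m *m A) (T) => q t; rewrite -phik0 opprB subrKA opprB subrKA.
move=> dw; have Te : `|T - phi 1%g - (xi + m *m A) - (m - (xi + m *m A))|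
    <= `|xi| / 4.
  rewrite (le_trans (ler_normB _ _))//.
  have eC : e * (1 + C) = 8^-1 by rewrite /e invfM divfK// gt_eqF// addr_gt0.
  have em : e * (`|xi| + `|m|) <= e * (1 + C) * `|xi|.
    by rewrite -mulrA ler_wpM2l ?(ltW e0)// mulrDl mul1r lerD2l.
  by rewrite eC in em dm; lra.
set S := _ - (m - _) in dw Te.
have := ler_normB S (S - w); rewrite subKr.
lra.
Qed.

(** If [k] minimises the distance of [k^-1 * h * k] to [g] plus [c] times the
    distance of [k] to [1], then [k^-1 * h * k = g]: otherwise an improving step
    [l] would halve the first term while the second grows, as [c] is small, by
    at most a quarter of the first. The point [k * l] cannot leave the ball on
    which the minimum is taken, as [h] is so close to [g] that the value at
    [k = 1] is smaller than the second term alone is outside the ball. *)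
Lemma conj_class_near_torsion g n : (0 < n)%N -> (g ^+ n)%g = 1%g ->
  nbhs g [set h : G | (h ^+ n)%g = 1%g -> conj_class g h].
Proof.
move=> n0 gn; have [C C0 step] := conj_improvement n0 gn.
have half0 : (0 : R) < 1 / 2 by rewrite divr_gt0.
have [V0 V01 dV] := mulg_strictly_additive half0.
have : nbhs (1 * 1 : G)%g (chart_dom a) by rewrite mulg1; exact: chart_dom_nbhs.
move=> /mulg_near[[V1 V2] /= [V11 V21] V12].
pose V := V0 `&` (V1 `&` V2).
have V_1 : nbhs (1%g : G) V by apply: filterI => //; exact: filterI.
have Sg : nbhs g _ := step _ V_1.
set S := (X in nbhs g X) in Sg.
have conjg_cvg : (fun p : G * G => p.1^-1 * p.2 * p.1)%g @ ((1%g : G), g) --> g.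
  rewrite -[X in _ --> X](mulg1 g) -[X in (X * _)%g](mul1g g).
  rewrite -[X in (X * _ * _)%g]invg1.
  do 2!(apply: cvg_mulg;
    last by [exact: cvg_snd|exact: cvg_fst|exact: cvg_cst]).
  apply: cvg_invg; exact: cvg_fst.
have : nbhs g (S `&` [set h | chart_dom a (h * g^-1)%g]).
  have domg := cvg_mulVr g (chart_dom_nbhs aa a1).
  apply: filterI => //; exact: domg.
move=> /conjg_cvg[[P Q] /= [P1 Qg] PQ].
have [r r0 rP] := (nbhs_rV_closed_ballP _ _).1
  (chart_inv_near aa a1 (filterI V_1 P1)).
(* [k * l] is further from 1 than [k] by at most [2 * C] times the distance of
   [k^-1 * h * k] to [g], so this [c] yields the quarter *)
pose c : R := (8 * C)^-1.
have c0 : 0 < c by rewrite invr_gt0 mulr_gt0.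
have hr : \forall h \near g, N (h * g^-1) <= c * r / 2.
  by apply: (cvg_mulVr g (chart_ball _)); rewrite divr_gt0// mulr_gt0.
apply: filterS2 Qg hr => h Qh hr hn.
pose f (v : 'rV[R]_d) :=
  N ((psi v)^-1 * h * psi v * g^-1) + c * `|v - phi 1%g|.
pose K := [set v : 'rV[R]_d | `|v - phi 1%g| <= r].
have K1 : K (phi 1%g) by rewrite /K/= subrr normr0 ltW.
have cptK : compact K.
  apply: bounded_closed_compact; last first.
    rewrite (_ : K = closed_ball_ Num.Def.normr (phi 1%g) r).
      exact: closed_closed_ball_.
    by apply/seteqP; split=> v; rewrite /K /closed_ball_/= distrC.
  exists (`|phi 1%g| + r); split; first exact: num_real.
  move=> M /ltW rM v Kv; apply: le_trans rM.
  by rewrite -[v](subrK (phi 1%g)) (le_trans (ler_normD _ _))// addrC lerD2l.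
have fcont : {within K, continuous f}.
  apply: continuous_in_subspaceT => v /set_mem Kv.
  have [codv [Vv Pv]] := rP _ Kv.
  have [_ domv] := PQ (psi v, h) (conj Pv Qh).
  have cpsi : psi @ v --> psi v by exact: (chart_inv_continuous aa codv).
  have cconj : (fun v => (psi v)^-1 * h * psi v * g^-1)%g @ v -->
      ((psi v)^-1 * h * psi v * g^-1)%g.
    do 3!(apply: (cvg_mulg (nbhs_filter v));
      last by [exact: cpsi|exact: cvg_cst]).
    by apply: (cvg_invg (nbhs_filter v)); exact: cpsi.
  apply: (cvg_weighted_dist (nbhs_filter v)); last exact: cvg_id.
  apply: (continuous_cvg (nbhs_filter v)) => //.
  exact: (chart_fun_continuous aa).
have [v /set_mem Kv vmin] := compact_EVT_min (ex_intro _ _ K1) cptK fcont.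
have [codv [Vv Pv]] := rP _ Kv.
set k := psi v in Vv Pv.
have [Sk domk] := PQ (k, h) (conj Pv Qh).
have [|l [Vl lC l2]] := Sk.
  have -> : ((k, h).1^-1 * (k, h).2 * (k, h).1 = h ^ k)%g.
    by rewrite conjgE mulgA.
  by rewrite -conjXg hn conj1g.
set h' := (k^-1 * h * k)%g in domk Sk lC l2.
have N0 := normr_ge0 (phi (h' * g^-1)%g - phi 1%g).
have Nkl : `|phi (k * l)%g - phi k| <= 2 * C * N (h' * g^-1).
  have := dV _ _ _ _ Vv.1 Vl.1 Vv.1 (nbhs_singleton V01).
  rewrite mulg1 subrr normr0 !add0r => H.
  have := ler_normD (phi (k * l)%g - phi k - (phi l - phi 1%g))
    (phi l - phi 1%g).
  have := mulr_ge0 (ltW C0) N0; rewrite subrK; lra.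
have Nkl1 : `|phi (k * l)%g - phi 1%g|
    <= `|v - phi 1%g| + 2 * C * N (h' * g^-1).
  rewrite -[phi (k * l)%g](subrK (phi k)) -addrA (le_trans (ler_normD _ _))//.
  by rewrite [leLHS]addrC lerD // /k chart_invK.
have cC : c * (2 * C * N (h' * g^-1)) = N (h' * g^-1) / 4.
  by rewrite /c; field; rewrite gt_eqF.
have fv : f v = N (h' * g^-1) + c * `|v - phi 1%g| by [].
have f1 : f (phi 1%g) = N (h * g^-1).
  by rewrite /f chart_funK// invg1 mul1g mulg1 subrr normr0 mulr0 addr0.
have := vmin _ (mem_set K1); rewrite f1 => minv1.
have := ler_wpM2l (ltW c0) Nkl1; rewrite mulrDr cC => cN.
have [klr|klr] := leP `|phi (k * l)%g - phi 1%g| r; last first.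
  have : c * r < c * `|phi (k * l)%g - phi 1%g| by rewrite ltr_pM2l.
  have := mulr_gt0 c0 r0. lra.
have domkl : chart_dom a (k * l)%g.
  by apply: (V12 (k, l)); split; [exact: Vv.2.1|exact: Vl.2.2].
have fkl : f (phi (k * l)%g) =
    N (l^-1 * h' * l * g^-1) + c * `|phi (k * l)%g - phi 1%g|.
  by rewrite /f chart_funK// invgM !mulgA.
have := vmin _ (mem_set (klr : K _)); rewrite fkl fv => minkl.
have N00 : N (h' * g^-1) = 0 by lra.
have h'g : h' = g.
  apply: divg1_eq; rewrite -[LHS](chart_funK aa)// -[RHS](chart_funK aa a1).
  by congr psi; apply/eqP; rewrite -subr_eq0 -normr_eq0 N00.
by exists k => //; rewrite -h'g /h' !mulgA mulgV mul1g mulgK.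
Qed.

End chart_at_identity.

(** * Components of the torsion set *)

Lemma conj_class_refl g : conj_class g g.
Proof. by exists 1%g; rewrite // mul1g invg1 mulg1. Qed.

Lemma conj_class_sym x y : conj_class x y -> conj_class y x.
Proof.
move=> [h _ <-]; exists h^-1%g => //.
by rewrite invgK !mulgA mulVg mul1g mulgVK.
Qed.

Lemma conj_class_trans x y (z : G) :
  conj_class x y -> conj_class y z -> conj_class x z.
Proof.
by move=> [h _ <-] [k _ <-]; exists (k * h)%g; rewrite // invgM !mulgA.
Qed.

Lemma conj_class_torsion g n : torsion_set G n g ->
  conj_class g `<=` torsion_set G n.
Proof.
move=> gn _ [h _ <-]; rewrite /torsion_set/=.
have -> : (h * g * h^-1 = g ^ (h^-1))%g by rewrite conjgE invgK mulgA.
by rewrite -conjXg gn conj1g.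
Qed.

Lemma connected_conj_class g : connected [set: G] -> connected (conj_class g).
Proof.
move=> cG; apply: connected_continuous_connected => //.
apply: continuous_subspaceT => h.
apply: cvg_mulg; last by apply: cvg_invg; exact: cvg_id.
by apply: cvg_mulg; [exact: cvg_id|exact: cvg_cst].
Qed.

(** Inside the component the conjugacy class of [g] is open, being a union of the
    neighbourhoods given by local rigidity at its points, and closed, its
    complement being the union of those at the other torsion elements. *)
Lemma component_sub_conj_class n g : (0 < n)%N -> torsion_set G n g ->
  connected_component (torsion_set G n) g `<=` conj_class g.
Proof.
move=> n0 gn; have [a aa a1] := atlas_cover (1%g : G).
set E := torsion_set G n; set C := connected_component E g.
have CE : C `<=` E by exact: connected_component_sub.
pose O (y : G) := interior [set h | E h -> conj_class y h].
have Oy y : E y -> O y y by exact: (conj_class_near_torsion aa a1 n0).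
have oO (D : set G) : open (\bigcup_(y in D) O y).
  by apply: bigcup_open => y _; exact: open_interior.
have OE y h : O y h -> E h -> conj_class y h by move=> /interior_subset.
suff <- : C `&` conj_class g = C by exact: subIsetr.
have cC : connected C by exact: component_connected.
apply: cC.
- by exists g; split; [exact: connected_component_refl|exact: conj_class_refl].
- exists (\bigcup_(y in E `&` conj_class g) O y) => //.
  apply/seteqP; split=> h [Ch]; last first.
    move=> [y [_ gy] Oh]; split => //.
    exact: conj_class_trans gy (OE _ _ Oh (CE _ Ch)).
  by move=> gh; split=> //; exists h; [split=> //; exact: CE|exact/Oy/CE].
- exists (~` \bigcup_(y in E `\` conj_class g) O y); first exact: open_closedC.
  apply/seteqP; split=> h [Ch].
    move=> gh; split=> // -[y [_ ngy] Oh]; apply: ngy.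
    by apply: conj_class_trans gh (conj_class_sym (OE _ _ Oh (CE _ Ch))).
  move=> nO; split=> //; apply: contrapT => ngh; apply: nO.
  exists h; last exact/Oy/CE.
  by split => //; exact: CE.
Qed.

End lie_group.

Theorem theorem1p1 (R : realType) (d : nat) (G : lieGroupType R d) (n : nat)
    (n_gt0 : (0 < n)%N) (connG : connected [set: G]) (C : set G) :
  is_component (torsion_set G n) C ->
  exists g : G, C = conj_class g.
Proof.
move=> [g gn ->]; exists g; apply/seteqP; split.
  exact: component_sub_conj_class.
apply: connected_component_max; first exact: conj_class_refl.
- exact: conj_class_torsion.
- exact: connected_conj_class.
Qed.
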